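(* Let $k$ and $l$ be positive integers with $l \leq k$ and $l$ dividing $k$. Then there exists (and one can explicitly construct) a $k$-uniform hypergraph that is not 2-colorable and has $$m(k,l) = \binom{2l - 1}{l} \cdot \left(\frac{2^{l} k}{l} \right)^{l} \cdot \binom{\frac{2^{l}}{l} k}{\frac{k}{l}}$$ edges.
   Context: A hypergraph is $k$-uniform if every edge is a set of exactly $k$ vertices. A hypergraph is 2-colorable if there is a coloring of its vertices with two colors (red and blue) such that no edge is monochromatic; ''not 2-colorable'' means every red/blue coloring of the vertices makes some edge monochromatic. *)

(* Defs.v *)
From mathcomp Require Import all_boot.
Set Implicit Arguments.
Unset Strict Implicit.
Unset Printing Implicit Defensive.

Record hypergraph := Hypergraph {
  vertex : finType;
  edges : {set {set vertex}}
}.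

Definition uniform (k : nat) (H : hypergraph) : Prop :=
  forall e : {set vertex H}, e \in edges H -> #|e| = k.

(* A red/blue coloring is a function to bool. *)
Definition monochromatic (T : finType) (f : T -> bool) (e : {set T}) : Prop :=
  exists c : bool, forall v : T, v \in e -> f v = c.

Definition two_colorable (H : hypergraph) : Prop :=
  exists f : vertex H -> bool,
    forall e : {set vertex H}, e \in edges H -> ~ monochromatic f e.

(* When l divides k, both truncated divisions below are exact. *)
Definition m (k l : nat) : nat :=
  'C(2 * l - 1, l) * ((2 ^ l * k) %/ l) ^ l * 'C((2 ^ l * k) %/ l, k %/ l).

(* Main.v *)
Require Import Defs.
From mathcomp Require Import all_boot.
From mathcomp Require Import all_algebra zify.

(** Write [q = k / l] and [N = 2 ^ l * q], and take [2 * l - 1] disjoint copies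
    (blocks) of the cyclic group of order [N].  An edge is given by [l] blocks,
    a [q]-subset [S] of the group, and a translate of [S] in each of the chosen
    blocks.  Under any coloring some [l] blocks have the same majority color
    [c]; over random translations, the [l] translated sets of points of color
    [c] have at least [N / 2 ^ l = q] common points on average, so some choice
    of translations leaves room for a set [S] giving a monochromatic edge.
    Different parameters may give the same edge, so the formula [m k l] only
    bounds the number of these edges from above, and the count is made exact by
    adding disjoint edges on new vertices. *)

Set Implicit Arguments.
Unset Strict Implicit.
Unset Printing Implicit Defensive.

Lemma subset_of_card (T : finType) (B : {set T}) n :
  n <= #|B| -> {A : {set T} | A \subset B & #|A| = n}.
Proof.
rewrite -bin_gt0 -cards_draws card_gt0 => /set0Pn/sigW[A].
by rewrite inE => /andP[sAB /eqP cA]; exists A.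
Qed.

Section Padding.

Variables (H : hypergraph) (k : nat).

Definition add_edge : hypergraph :=
  @Hypergraph (vertex H + 'I_k)%type
    ([set inr i | i : 'I_k] |: [set inl @: e | e : {set vertex H} in edges H]).

Lemma add_edge_uniform : uniform k H -> uniform k add_edge.
Proof.
move=> uH e /setU1P[->|/imsetP[e' e'H ->]].
  by rewrite card_imset ?card_ord //; apply: inr_inj.
by rewrite card_imset ?uH //; apply: inl_inj.
Qed.

Lemma add_edge_not_two_colorable :
  ~ two_colorable H -> ~ two_colorable add_edge.
Proof.
move=> nH [f nf]; apply: nH; exists (f \o inl) => e eH [c fc].
apply: (nf (inl @: e)); first by apply/setU1P; right; apply: imset_f.
by exists c => _ /imsetP[v ve ->]; apply: fc.
Qed.

(** As [k] is positive, the new edge contains a point [inr _], whereas old edges lie in the image of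
    [inl]; so the new edge is none of them. *)
Lemma card_add_edge : 0 < k -> #|edges add_edge| = #|edges H|.+1.
Proof.
move=> k0; rewrite cardsU1 card_imset; last exact: imset_inj (@inl_inj _ _).
case: imsetP => // -[e _ /setP/(_ (inr (Ordinal k0)))].
by rewrite imset_f //; case/esym/imsetP.
Qed.

End Padding.

Lemma pad_hypergraph (k n : nat) (H : hypergraph) : 0 < k ->
    uniform k H -> ~ two_colorable H -> #|edges H| <= n ->
  {H' : hypergraph | [/\ uniform k H', ~ two_colorable H' & #|edges H'| = n]}.
Proof.
move=> k0 uH nH leHn.
suff [H' [uH' nH' cH']] : {H' : hypergraph | [/\ uniform k H',
    ~ two_colorable H' & #|edges H'| = n - #|edges H| + #|edges H|]}.
  by exists H'; split; rewrite // cH' subnK.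
elim: (n - _) => [|d [H' [uH' nH' cH']]]; first by exists H.
exists (add_edge H' k); split.
- exact: add_edge_uniform.
- exact: add_edge_not_two_colorable.
- by rewrite card_add_edge // cH'.
Qed.

Section Translates.

Import GRing.Theory.
Local Open Scope ring_scope.

Variable G : finZmodType.

(** Double counting of pairs [(a, x)]: for fixed [x] the coordinates of [a] are chosen
    independently, with [#|R j|] choices for coordinate [j], because adding [x] is a bijection. *)
Lemma sum_card_common_translates (J : finType) (R : J -> {set G}) :
  (\sum_(a : {ffun J -> G}) #|[set x | [forall j, (x + a j)%R \in R j]]|
    = #|G| * \prod_j #|R j|)%N.
Proof.
transitivity (\sum_(a : {ffun J -> G})
                \sum_(x : G) \prod_j ((x + a j)%R \in R j : nat))%N.
  apply: eq_bigr => a _; rewrite -sum1_card big_mkcond; apply: eq_bigr => x _.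
  rewrite inE; case: forallP => [aR | naR]; first by rewrite big1 // => j _; rewrite aR.
  have [j /negbTE njR] : exists j, (x + a j)%R \notin R j.
    by apply/existsP; rewrite -negb_forall; apply/forallP.
  by rewrite (bigD1 j) //= njR.
rewrite exchange_big -sum_nat_const; apply: eq_bigr => x _.
rewrite -(bigA_distr_bigA (fun j y => (x + y)%R \in R j : nat)) /=.
apply: eq_bigr => j _; rewrite -sum1_card [RHS]big_mkcond.
by rewrite [RHS](reindex_inj (addrI x)); apply: eq_bigr => y _; case: ifP.
Qed.

Lemma large_common_translates (J : finType) (R : J -> {set G}) q :
    #|G| = (2 ^ #|J| * q)%N -> (forall j, #|G| <= 2 * #|R j|)%N ->
  exists a : {ffun J -> G},
    (q <= #|[set x | [forall j, (x + a j)%R \in R j]]|)%N.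
Proof.
move=> cG cR; apply/existsP; apply: contraT.
rewrite negb_exists => /forallP small.
have G0 : (0 < #|G|)%N by apply/card_gt0P; exists 0.
have: (#|G| ^ #|J| <= 2 ^ #|J| * \prod_j #|R j|)%N.
  by rewrite -!prod_nat_const -big_split /=; apply: leq_prod.
(* The summand [1] records that each count is strictly below [q]. *)
have: (\sum_(a : {ffun J -> G})
    (1 + #|[set x | [forall j, (x + a j)%R \in R j]]|) <= #|G| ^ #|J| * q)%N.
  rewrite -card_ffun -sum_nat_const; apply: leq_sum => a _.
  by rewrite add1n ltnNge small.
rewrite big_split /= sum_card_common_translates sum1_card card_ffun.
have: (0 < #|G| ^ #|J|)%N by rewrite expn_gt0 G0.
(* Now [A <= t * P] and [A + t * q * P <= A * q] contradict [0 < A]. *)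
move: (#|G| ^ #|J|)%N (\prod_j _)%N => A P; rewrite cG.
by move: (2 ^ #|J|)%N => t; nia.
Qed.

Variables l q : nat.

Local Notation block := 'I_(2 * l - 1).

(** Translations are indexed by the rank of [b] in [I], so that they form an [l]-tuple, with
    [#|G| ^ l] possibilities for every [I]. When [#|I| = l], the default [0] is reached only outside
    [I]. *)
Definition shift (I : {set block}) (a : l.-tuple G) (b : block) : G :=
  nth 0 a (index b (enum I)).

Definition translates (p : {set block} * l.-tuple G * {set G}) :
    {set block * G} :=
  [set (u.1, u.2 + shift p.1.1 p.1.2 u.1) | u in setX p.1.1 p.2].

Definition translate_hypergraph : hypergraph :=
  @Hypergraph (block * G)%type
    (translates @: setX (setX [set I : {set block} | #|I| == l] setT)
                        [set S : {set G} | #|S| == q]).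

Lemma translate_hypergraph_uniform : uniform (l * q) translate_hypergraph.
Proof.
move=> _ /imsetP[[[I a] S] + ->]; rewrite !inE /= andbT => /andP[/eqP cI /eqP cS].
rewrite card_imset ?cardsX ?cI ?cS // => -[b x] [b' x'] /= [<-].
by move/addIr->.
Qed.

Lemma card_translate_hypergraph :
  (#|edges translate_hypergraph| <= 'C(2 * l - 1, l) * #|G| ^ l * 'C(#|G|, q))%N.
Proof.
apply: leq_trans (leq_imset_card _ _) _.
by rewrite !cardsX !card_draws cardsT card_tuple card_ord.
Qed.

(** Pigeonhole: of the [2 * l - 1] blocks, at least [l] lie in [M] or at least [l] lie outside it,
    and a block outside [M] has more than half of its points colored [false]. *)
Lemma majority_blocks (f : block * G -> bool) : (0 < l)%N ->
  exists (c : bool) (I : {set block}), #|I| = l /\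
    forall b, b \in I -> (#|G| <= 2 * #|[set x | f (b, x) == c]|)%N.
Proof.
move=> l0; pose F (b : block) := [set x | f (b, x)].
pose M := [set b | (#|G| <= 2 * #|F b|)%N].
have cM : (#|M| + #|~: M| = 2 * l - 1)%N by rewrite cardsC card_ord.
have [lM|Ml] := leqP l #|M|.
  have [I /subsetP sIM cI] := subset_of_card lM.
  exists true, I; split=> // b /sIM; rewrite inE => /leq_trans; apply.
  by rewrite leq_mul2l subset_leq_card //; apply/subsetP=> x; rewrite !inE => ->.
have [|I /subsetP sIM cI] := @subset_of_card _ (~: M) l; first by lia.
exists false, I; split=> // b /sIM; rewrite !inE -ltnNge.
have -> : [set x | f (b, x) == false] = ~: F b.
  by apply/setP=> x; rewrite !inE eqbF_neg.
by have := cardsC (F b); move: #|F b| #|~: F b| #|G| => r s n; lia.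
Qed.

Lemma translate_hypergraph_not_two_colorable :
  (0 < l)%N -> #|G| = (2 ^ l * q)%N -> ~ two_colorable translate_hypergraph.
Proof.
move=> l0 cG [f nf]; have [c [I [cI majI]]] := majority_blocks f l0.
have szI : size (enum I) = l by rewrite -cardE.
have b0 : block by apply: (@Ordinal _ 0); lia.
pose R (j : 'I_l) := [set x | f (nth b0 (enum I) j, x) == c].
have [||a] := @large_common_translates _ R q; first by rewrite card_ord.
  by move=> j; apply: majI; rewrite -mem_enum mem_nth ?szI.
case/subset_of_card=> S /subsetP sS cS.
apply: (nf (translates (I, [tuple a j | j < l], S))).
  by apply: imset_f; rewrite !inE /= cI cS !eqxx.
exists c => _ /imsetP[[b x] /setXP[/= bI xS] ->] /=.
have ltb : (index b (enum I) < l)%N by rewrite -[ltnRHS]szI index_mem mem_enum.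
have := sS _ xS; rewrite inE => /forallP/(_ (Ordinal ltb)).
rewrite inE nth_index ?mem_enum // => /eqP <-.
by rewrite /shift -[index b _]/(val (Ordinal ltb)) -tnth_nth tnth_mktuple.
Qed.

End Translates.

Theorem theorem1p1 (k l : nat) (k_gt0 : 0 < k) (l_gt0 : 0 < l)
    (l_le_k : l <= k) (l_dvd_k : l %| k) :
  {H : hypergraph |
    [/\ uniform k H, ~ two_colorable H & #|edges H| = m k l]}.
Proof.
pose q := k %/ l; have kE : k = l * q by rewrite mulnC divnK.
have N_gt0 : 0 < 2 ^ l * q by rewrite muln_gt0 expn_gt0 divn_gt0.
(* The successor form gives the ordinals their cyclic group structure; the order is right since
   [N_gt0] holds. *)
pose G : finZmodType := 'I_(2 ^ l * q).-1.+1.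
have cG : #|G| = 2 ^ l * q by rewrite card_ord prednK.
apply: (@pad_hypergraph k _ (translate_hypergraph G l q)) => //.
- by rewrite kE; apply: translate_hypergraph_uniform.
- exact: translate_hypergraph_not_two_colorable.
- by rewrite /m -muln_divA // -/q -cG; apply: card_translate_hypergraph.
Qed.
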